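(* Observation congruence is transitive: for all CCS processes $E, E', E''$, if $E \approx^c E'$ and $E' \approx^c E''$, then $E \approx^c E''$.
   Context: Processes. Let $\alpha$ and $\beta$ be nonempty sets. Labels are $\mathrm{name}(b)$ and $\mathrm{coname}(b)$ for $b\in\beta$; the complement $\overline{\cdot}$ exchanges $\mathrm{name}(b)$ and $\mathrm{coname}(b)$. Actions are $\tau$ and the labels. CCS processes are the terms freely generated by: $\mathrm{nil}$; variables (constants) $X\in\alpha$; $u.E$ ($u$ an action); $E+E'$; $E\,||\,E'$; $\nu L\,E$ ($L$ a set of labels); $\mathrm{relab}(E,f)$ ($f$ a function from labels to labels commuting with complement, extended to actions by $f(\tau)=\tau$); $\mathrm{rec}\,X.E$. The transition relation $E\xrightarrow{u}E'$ is the least relation such that: $u.E\xrightarrow{u}E$; if $E\xrightarrow{u}E_1$ then $E+E'\xrightarrow{u}E_1$ and $E'+E\xrightarrow{u}E_1$; if $E\xrightarrow{u}E_1$ then $E||E'\xrightarrow{u}E_1||E'$ and $E'||E\xrightarrow{u}E'||E_1$; if $E\xrightarrow{l}E_1$ and $E'\xrightarrow{\overline{l}}E_2$ for a label $l$ then $E||E'\xrightarrow{\tau}E_1||E_2$; if $E\xrightarrow{u}E_1$ and either $u=\tau$ or $u$ is a label with $u,\overline{u}\notin L$, then $\nu L\,E\xrightarrow{u}\nu L\,E_1$; if $E\xrightarrow{u}E_1$ then $\mathrm{relab}(E,f)\xrightarrow{f(u)}\mathrm{relab}(E_1,f)$; if $E\{\mathrm{rec}\,X.E/X\}\xrightarrow{u}E_1$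 then $\mathrm{rec}\,X.E\xrightarrow{u}E_1$ (the substitution replaces the occurrences of $X$ not under a binder $\mathrm{rec}\,X$). Weak notions. $E\overset{\epsilon}{\Rightarrow}E'$ is the reflexive transitive closure of $\xrightarrow{\tau}$. For any action $u$ (including $\tau$), $E\overset{u}{\Rightarrow}E'$ means there are $E_1,E_2$ with $E\overset{\epsilon}{\Rightarrow}E_1\xrightarrow{u}E_2\overset{\epsilon}{\Rightarrow}E'$. A relation $W$ on processes is a weak bisimulation if whenever $W\,E\,E'$: for each label $l$, $E\xrightarrow{l}E_1$ implies there is $E_2$ with $E'\overset{l}{\Rightarrow}E_2$ and $W\,E_1\,E_2$, and $E'\xrightarrow{l}E_2$ implies there is $E_1$ with $E\overset{l}{\Rightarrow}E_1$ and $W\,E_1\,E_2$; and $E\xrightarrow{\tau}E_1$ implies there is $E_2$ with $E'\overset{\epsilon}{\Rightarrow}E_2$ and $W\,E_1\,E_2$, and $E'\xrightarrow{\tau}E_2$ implies there is $E_1$ with $E\overset{\epsilon}{\Rightarrow}E_1$ and $W\,E_1\,E_2$. Weak equivalence: $E\approx E'$ iff $W\,E\,E'$ for some weak bisimulation $W$. Observation congruence: $E\approx^c E'$ iff for every action $u$ (including $\tau$): for every $E_1$ with $E\xrightarrow{u}E_1$ there is $E_2$ with $E'\overset{u}{\Rightarrow}E_2$ and $E_1\approx E_2$; and for every $E_2$ with $E'\xrightarrow{u}E_2$ there is $E_1$ with $E\overset{u}{\Rightarrow}E_1$ and $E_1\approx E_2$. *)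

(* Defs.v *)
From Stdlib Require Import Relations Ensembles ClassicalEpsilon.

Inductive label (beta : Type) : Type :=
  | name (b : beta)
  | coname (b : beta).
Arguments name {beta} b.
Arguments coname {beta} b.

Definition compl {beta : Type} (l : label beta) : label beta :=
  match l with
  | name b => coname b
  | coname b => name b
  end.

Inductive action (beta : Type) : Type :=
  | tau
  | act (l : label beta).
Arguments tau {beta}.
Arguments act {beta} l.

Record relabeling (beta : Type) : Type := Relabeling {
  relabel_fun : label beta -> label beta;
  relabel_compl : forall l : label beta,
      relabel_fun (compl l) = compl (relabel_fun l)
}.
Arguments Relabeling {beta} relabel_fun relabel_compl.
Arguments relabel_fun {beta} r l.
Arguments relabel_compl {beta} r l.

Definition relabel_action {beta : Type} (f : relabeling beta) (u : action beta)
  : action beta :=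
  match u with
  | tau => tau
  | act l => act (relabel_fun f l)
  end.

Inductive CCS (alpha beta : Type) : Type :=
  | nil
  | var (X : alpha)
  | prefix (u : action beta) (E : CCS alpha beta)
  | sum (E E' : CCS alpha beta)
  | par (E E' : CCS alpha beta)
  | restr (L : Ensemble (label beta)) (E : CCS alpha beta)
  | relab (E : CCS alpha beta) (f : relabeling beta)
  | rec (X : alpha) (E : CCS alpha beta).
Arguments nil {alpha beta}.
Arguments var {alpha beta} X.
Arguments prefix {alpha beta} u E.
Arguments sum {alpha beta} E E'.
Arguments par {alpha beta} E E'.
Arguments restr {alpha beta} L E.
Arguments relab {alpha beta} E f.
Arguments rec {alpha beta} X E.

(* [subst E F X] is E{F/X}. Bound variables of E are never renamed, so free
   variables of F may be captured. Since [alpha] is an arbitrary type, variables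
   are compared by classical excluded middle. *)
Fixpoint subst {alpha beta : Type} (E F : CCS alpha beta) (X : alpha)
  : CCS alpha beta :=
  match E with
  | nil => nil
  | var Y => if excluded_middle_informative (Y = X) then F else var Y
  | prefix u E1 => prefix u (subst E1 F X)
  | sum E1 E2 => sum (subst E1 F X) (subst E2 F X)
  | par E1 E2 => par (subst E1 F X) (subst E2 F X)
  | restr L E1 => restr L (subst E1 F X)
  | relab E1 f => relab (subst E1 F X) f
  | rec Y E1 =>
      if excluded_middle_informative (Y = X) then rec Y E1
      else rec Y (subst E1 F X)
  end.

Inductive trans {alpha beta : Type}
  : CCS alpha beta -> action beta -> CCS alpha beta -> Prop :=
  | trans_prefix u E :
      trans (prefix u E) u E
  | trans_sum_l u E E' E1 :
      trans E u E1 -> trans (sum E E') u E1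
  | trans_sum_r u E E' E1 :
      trans E u E1 -> trans (sum E' E) u E1
  | trans_par_l u E E' E1 :
      trans E u E1 -> trans (par E E') u (par E1 E')
  | trans_par_r u E E' E1 :
      trans E u E1 -> trans (par E' E) u (par E' E1)
  | trans_par_comm l E E' E1 E2 :
      trans E (act l) E1 -> trans E' (act (compl l)) E2 ->
      trans (par E E') tau (par E1 E2)
  | trans_restr u L E E1 :
      trans E u E1 ->
      (u = tau \/
       exists l, u = act l /\ ~ In _ L l /\ ~ In _ L (compl l)) ->
      trans (restr L E) u (restr L E1)
  | trans_relab u f E E1 :
      trans E u E1 -> trans (relab E f) (relabel_action f u) (relab E1 f)
  | trans_rec u X E E1 :
      trans (subst E (rec X E) X) u E1 -> trans (rec X E) u E1.

Definition eps_trans {alpha beta : Type} : relation (CCS alpha beta) :=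
  clos_refl_trans (CCS alpha beta) (fun E E' => trans E tau E').

(* For [u = tau] at least one tau transition is required. *)
Definition weak_trans {alpha beta : Type}
  (E : CCS alpha beta) (u : action beta) (E' : CCS alpha beta) : Prop :=
  exists E1 E2, eps_trans E E1 /\ trans E1 u E2 /\ eps_trans E2 E'.

Definition weak_bisim {alpha beta : Type} (W : relation (CCS alpha beta))
  : Prop :=
  forall E E', W E E' ->
    (forall l : label beta,
       (forall E1, trans E (act l) E1 ->
          exists E2, weak_trans E' (act l) E2 /\ W E1 E2) /\
       (forall E2, trans E' (act l) E2 ->
          exists E1, weak_trans E (act l) E1 /\ W E1 E2)) /\
    (forall E1, trans E tau E1 ->
       exists E2, eps_trans E' E2 /\ W E1 E2) /\
    (forall E2, trans E' tau E2 ->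
       exists E1, eps_trans E E1 /\ W E1 E2).

Definition weak_equiv {alpha beta : Type} (E E' : CCS alpha beta) : Prop :=
  exists W : relation (CCS alpha beta), weak_bisim W /\ W E E'.

Definition obs_congr {alpha beta : Type} (E E' : CCS alpha beta) : Prop :=
  forall u : action beta,
    (forall E1, trans E u E1 ->
       exists E2, weak_trans E' u E2 /\ weak_equiv E1 E2) /\
    (forall E2, trans E' u E2 ->
       exists E1, weak_trans E u E1 /\ weak_equiv E1 E2).

(* Main.v *)
(* A weak transition of E is answered by E' one step at a time.  The delicate
   case is a weak tau transition, which must be answered by at least one tau
   step although weak equivalence may answer with none: the first step of E is
   taken at the root, where observation congruence supplies the required step,
   and every later step is answered by weak equivalence.  Transitivity then
   reduces to that of weak equivalence. *)
From Stdlib Require Import Relations.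
Require Import Defs.

Lemma eps_weak_trans {alpha beta : Type} (E F G : CCS alpha beta) u :
  eps_trans E F -> weak_trans F u G -> weak_trans E u G.
Proof.
  intros HEF (F1 & F2 & HF1 & HF12 & HF2).
  exists F1, F2; split; [|tauto].
  now apply rt_trans with F.
Qed.

Lemma weak_eps_trans {alpha beta : Type} (E F G : CCS alpha beta) u :
  weak_trans E u F -> eps_trans F G -> weak_trans E u G.
Proof.
  intros (E1 & E2 & HE1 & HE12 & HE2) HFG.
  exists E1, E2; repeat split; trivial.
  now apply rt_trans with F.
Qed.

Lemma weak_trans_tau_eps {alpha beta : Type} (E F : CCS alpha beta) :
  weak_trans E tau F -> eps_trans E F.
Proof.
  intros (E1 & E2 & HE1 & HE12 & HE2).
  apply rt_trans with E1; trivial.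
  apply rt_trans with E2; trivial.
  now apply rt_step.
Qed.

(** The standard hatted arrow: [tau] may be matched by no step at all, unlike in [weak_trans]. It
    merges the label and [tau] clauses of [weak_bisim] into one. *)
Definition weak_hat_trans {alpha beta : Type}
  (E : CCS alpha beta) (u : action beta) (E' : CCS alpha beta) : Prop :=
  match u with
  | tau => eps_trans E E'
  | act l => weak_trans E (act l) E'
  end.

(** One half of a weak bisimulation, isolated so that each lifting argument is made in one direction
    only. *)
Definition weak_sim {alpha beta : Type} (W : relation (CCS alpha beta)) : Prop :=
  forall E E', W E E' -> forall u E1, trans E u E1 ->
    exists E2, weak_hat_trans E' u E2 /\ W E1 E2.

Lemma weak_bisim_sim {alpha beta : Type} (W : relation (CCS alpha beta)) :
  weak_bisim W <-> weak_sim W /\ weak_sim (transp _ W).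
Proof.
  split.
  - intros HW; split; intros E E' HE u E1 Ht;
      destruct (HW _ _ HE) as (Hl & Htl & Htr); destruct u as [|l]; cbn.
    + exact (Htl _ Ht).
    + exact (proj1 (Hl l) _ Ht).
    + exact (Htr _ Ht).
    + exact (proj2 (Hl l) _ Ht).
  - intros [Hsim Hsim'] E E' HE; repeat split.
    + exact (Hsim _ _ HE (act l)).
    + exact (Hsim' _ _ HE (act l)).
    + exact (Hsim _ _ HE tau).
    + exact (Hsim' _ _ HE tau).
Qed.

Lemma weak_sim_eps {alpha beta : Type} (W : relation (CCS alpha beta)) :
  weak_sim W -> forall E E1, eps_trans E E1 -> forall E', W E E' ->
    exists E2, eps_trans E' E2 /\ W E1 E2.
Proof.
  intros HW E E1 Heps; induction Heps as [E E1 Ht|E|E F G _ IH1 _ IH2];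
    intros E' HE.
  - exact (HW _ _ HE _ _ Ht).
  - exists E'; split; trivial; apply rt_refl.
  - destruct (IH1 _ HE) as (F' & HF' & HF).
    destruct (IH2 _ HF) as (G' & HG' & HG).
    exists G'; split; trivial; now apply rt_trans with F'.
Qed.

(** The three segments of the weak transition are simulated in turn and concatenated. Only a hatted
    answer results, since for [u = tau] all three may be answered by nothing. *)
Lemma weak_sim_weak {alpha beta : Type} (W : relation (CCS alpha beta)) :
  weak_sim W -> forall E u E1, weak_trans E u E1 -> forall E', W E E' ->
    exists E2, weak_hat_trans E' u E2 /\ W E1 E2.
Proof.
  intros HW E u E1 (F & G & HF & HFG & HG) E' HE.
  destruct (weak_sim_eps W HW _ _ HF _ HE) as (F' & HF' & HWF).
  destruct (HW _ _ HWF _ _ HFG) as (G' & HG' & HWG).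
  destruct (weak_sim_eps W HW _ _ HG _ HWG) as (E2 & HE2 & HWE).
  exists E2; split; trivial.
  destruct u as [|l]; cbn in *.
  - apply rt_trans with F'; trivial; now apply rt_trans with G'.
  - apply eps_weak_trans with F'; trivial; now apply weak_eps_trans with G'.
Qed.

Lemma weak_sim_hat {alpha beta : Type} (W : relation (CCS alpha beta)) :
  weak_sim W -> forall E u E1, weak_hat_trans E u E1 -> forall E', W E E' ->
    exists E2, weak_hat_trans E' u E2 /\ W E1 E2.
Proof.
  intros HW E [|l] E1.
  - exact (weak_sim_eps W HW E E1).
  - exact (weak_sim_weak W HW E (act l) E1).
Qed.

Lemma weak_equiv_sym {alpha beta : Type} (E E' : CCS alpha beta) :
  weak_equiv E E' -> weak_equiv E' E.
Proof.
  intros (W & HW & HE); exists (transp _ W); split; trivial.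
  apply weak_bisim_sim in HW as [Hsim Hsim'].
  now apply weak_bisim_sim.
Qed.

(** The bisimulation witnessing a pair also witnesses the derivatives. *)
Lemma weak_equiv_sim (alpha beta : Type) : weak_sim (@weak_equiv alpha beta).
Proof.
  intros E E' (W & HW & HE) u E1 Ht.
  destruct (proj1 (proj1 (weak_bisim_sim W) HW) _ _ HE _ _ Ht)
    as (E2 & HE2 & HWE).
  exists E2; split; trivial; now exists W.
Qed.

Lemma weak_equiv_trans {alpha beta : Type} (E E' E'' : CCS alpha beta) :
  weak_equiv E E' -> weak_equiv E' E'' -> weak_equiv E E''.
Proof.
  intros HE HE'.
  (* Composing the full [weak_equiv] with itself, rather than two chosen bisimulations, lets
     symmetry of [weak_equiv] handle the converse. The middle process may answer with several steps,
     hence [weak_sim_hat] for the second factor. *)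
  exists (fun F H => exists G, weak_equiv F G /\ weak_equiv G H).
  split; [|now exists E'].
  apply weak_bisim_sim; split.
  - intros F H (G & HFG & HGH) u F1 Ht.
    destruct (weak_equiv_sim _ _ _ _ HFG _ _ Ht) as (G1 & HG1 & HFG1).
    destruct (weak_sim_hat _ (weak_equiv_sim _ _) _ _ _ HG1 _ HGH)
      as (H1 & HH1 & HGH1).
    exists H1; split; trivial; now exists G1.
  - intros H F (G & HFG & HGH) u H1 Ht.
    apply weak_equiv_sym in HFG, HGH.
    destruct (weak_equiv_sim _ _ _ _ HGH _ _ Ht) as (G1 & HG1 & HGH1).
    destruct (weak_sim_hat _ (weak_equiv_sim _ _) _ _ _ HG1 _ HFG)
      as (F1 & HF1 & HFG1).
    exists F1; split; trivial.
    exists G1; split; now apply weak_equiv_sym.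
Qed.

Lemma obs_congr_sym {alpha beta : Type} (E E' : CCS alpha beta) :
  obs_congr E E' -> obs_congr E' E.
Proof.
  intros HE u; destruct (HE u) as [Hl Hr]; split; intros F Ht.
  - destruct (Hr _ Ht) as (G & HG & HFG); exists G; auto using weak_equiv_sym.
  - destruct (Hl _ Ht) as (G & HG & HFG); exists G; auto using weak_equiv_sym.
Qed.

Lemma obs_congr_weak {alpha beta : Type} (E E' E1 : CCS alpha beta) u :
  obs_congr E E' -> weak_trans E u E1 ->
  exists E2, weak_trans E' u E2 /\ weak_equiv E1 E2.
Proof.
  intros HE (F & G & HF & HFG & HG).
  (* The closure is unfolded from the left to expose the first step from [E]: either the [u] step
     itself or a leading [tau] step to [D]. *)
  apply clos_rt_rt1n in HF; destruct HF as [|D F HD HF].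
  - destruct (proj1 (HE u) _ HFG) as (G' & HG' & HGG').
    destruct (weak_sim_eps _ (weak_equiv_sim _ _) _ _ HG _ HGG')
      as (E2 & HE2 & HE12).
    exists E2; split; trivial; now apply weak_eps_trans with G'.
  - destruct (proj1 (HE tau) _ HD) as (D' & HD' & HDD').
    apply clos_rt1n_rt in HF.
    assert (HDE1 : weak_trans D u E1) by now exists F, G.
    destruct (weak_sim_weak _ (weak_equiv_sim _ _) _ _ _ HDE1 _ HDD')
      as (E2 & HE2 & HE12).
    exists E2; split; trivial.
    (* For [tau] the answer from [D'] may be empty, but reaching [D'] from [E'] already took a [tau]
       step. For a label, the path to [D'] is absorbed as leading [tau] steps. *)
    destruct u as [|l]; cbn in HE2.
    + now apply weak_eps_trans with D'.
    + apply eps_weak_trans with D'; trivial; now apply weak_trans_tau_eps.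
Qed.

Lemma obs_congr_trans_step {alpha beta : Type} (E E' E'' E1 : CCS alpha beta) u :
  obs_congr E E' -> obs_congr E' E'' -> trans E u E1 ->
  exists E2, weak_trans E'' u E2 /\ weak_equiv E1 E2.
Proof.
  intros HE HE' Ht.
  destruct (proj1 (HE u) _ Ht) as (F & HF & HEF).
  destruct (obs_congr_weak _ _ _ _ HE' HF) as (E2 & HE2 & HFE).
  exists E2; split; trivial; now apply weak_equiv_trans with F.
Qed.

Theorem theorem5 (alpha beta : Type)
    (alpha_nonempty : inhabited alpha) (beta_nonempty : inhabited beta)
    (E E' E'' : CCS alpha beta) :
  obs_congr E E' -> obs_congr E' E'' -> obs_congr E E''.
Proof.
  intros HE HE' u; split; intros F Ht.
  - exact (obs_congr_trans_step _ _ _ _ _ HE HE' Ht).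
  (* The second clause is the first one for the reversed chain from [E''] through [E'] to [E]. *)
  - destruct (obs_congr_trans_step _ _ _ _ _
      (obs_congr_sym _ _ HE') (obs_congr_sym _ _ HE) Ht) as (G & HG & HFG).
    exists G; auto using weak_equiv_sym.
Qed.
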